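(* Let $G \in \mathbb{R}^{N\times N}$ be a real symmetric matrix (weighted undirected graph) with vertex set $\mathbb{V} = \{1,\dots,N\}$ and two cospectral vertices $u,v \in \mathbb{V}$. Then: (i) For a subset $\mathbb{M} \subseteq \mathbb{V}$ and real weight tuple $\gamma = (\gamma_m)_{m\in\mathbb{M}}$, the vertices $u,v$ are cospectral in the weighted cone $H$ of $G$ over $\mathbb{M}$ with weight tuple $\gamma$ if and only if $\mathbb{M}_\gamma^p$ is a walk multiplet of $G$ relative to $u,v$ for some parity $p \in \{+1,-1\}$. (ii) For a vertex $c \in \mathbb{V}$, the vertices $u,v$ are cospectral in the graph $R = G\setminus c$ (the principal submatrix of $G$ obtained by deleting row and column $c$) if and only if $c$ is a walk singlet of $G$ relative to $u,v$ (with some parity $p\in\{+1,-1\}$).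
   Context: A real symmetric matrix $H \in \mathbb{R}^{n\times n}$ is identified with an undirected weighted graph on vertices $1,\dots,n$, with edge weight $H_{i,j}$ (diagonal entries are loops). Two vertices $u,v$ are cospectral in $H$ if $[H^k]_{u,u} = [H^k]_{v,v}$ for all integers $k \geq 0$. Given a vertex subset $\mathbb{M}$, a tuple $\gamma = (\gamma_m)_{m\in\mathbb{M}}$ of real numbers, and $p\in\{+1,-1\}$, $\mathbb{M}$ is a walk multiplet $\mathbb{M}_\gamma^p$ of $H$ relative to $u,v$ with parity $p$ if $\sum_{m\in\mathbb{M}}\gamma_m [H^k]_{u,m} = p\sum_{m\in\mathbb{M}}\gamma_m[H^k]_{v,m}$ for all $k \in\{0,\dots,n-1\}$ (equivalently for all integers $k\geq0$). A vertex $c$ is a walk singlet relative to $u,v$ with parity $p$ if $[H^k]_{u,c} = p[H^k]_{v,c}$ for all $k\ge 0$. The weighted cone of $G\in\mathbb{R}^{N\times N}$ over $\mathbb{M}$ with weight tuple $\gamma$ is $H = \begin{bmatrix} G & e_\mathbb{M}^\gamma\\ (e_\mathbb{M}^\gamma)^\top & 0\end{bmatrix}$, where $e_\mathbb{M}^\gamma\in\mathbb{R}^N$ has entries $\gamma_m$ for $m\in\mathbb{M}$ and $0$ otherwise. *)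

(* Defs.v *)
From HB Require Import structures.
From mathcomp Require Import all_boot all_order all_algebra.
From mathcomp Require Import reals.

Set Implicit Arguments.
Unset Strict Implicit.
Unset Printing Implicit Defensive.

Import GRing.Theory.
Local Open Scope ring_scope.

Section Defs.
Variable R : realType.

Definition cospectral (n : nat) (H : 'M[R]_n) (u v : 'I_n) : Prop :=
  forall k : nat, (H ^+ k) u u = (H ^+ k) v v.

Definition parity (p : R) : Prop := p = 1 \/ p = -1.

(* A weight tuple indexed by M is given by a function on all vertices; its
   values outside M are never used, here or in [indicator]. *)
Definition walk_multiplet (n : nat) (H : 'M[R]_n) (u v : 'I_n)
    (M : {set 'I_n}) (gamma : 'I_n -> R) (p : R) : Prop :=
  forall k : nat, (k < n)%N ->
    \sum_(m in M) gamma m * (H ^+ k) u m =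
    p * \sum_(m in M) gamma m * (H ^+ k) v m.

Definition walk_singlet (n : nat) (H : 'M[R]_n) (u v c : 'I_n) (p : R) : Prop :=
  forall k : nat, (H ^+ k) u c = p * (H ^+ k) v c.

Definition indicator (n : nat) (M : {set 'I_n}) (gamma : 'I_n -> R) : 'cV[R]_n :=
  \col_i (if i \in M then gamma i else 0).

(* Vertex i of G is vertex [lshift 1 i] of the cone. *)
Definition cone (n : nat) (G : 'M[R]_n) (M : {set 'I_n}) (gamma : 'I_n -> R) :
    'M[R]_(n + 1) :=
  block_mx G (indicator M gamma) (indicator M gamma)^T 0.

Definition vertex_del (n : nat) (G : 'M[R]_n) (c : 'I_n) : 'M[R]_n.-1 :=
  row' c (col' c G).

(* Vertex i of [vertex_del G c] is vertex [lift c i] of G. Being cospectral in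
   the vertex-deleted graph includes being vertices of it, so this is false
   when u = c or v = c. *)
Definition cospectral_del (n : nat) (G : 'M[R]_n) (c u v : 'I_n) : Prop :=
  exists u' v' : 'I_n.-1,
    [/\ lift c u' = u, lift c v' = v & cospectral (vertex_del G c) u' v'].

End Defs.

(* Main.v *)
Require Import Defs.
From HB Require Import structures.
From mathcomp Require Import all_boot all_order all_algebra.
From mathcomp Require Import boolp reals.
From mathcomp Require Import ring.

(** Split the index set of a symmetric matrix [K] into one vertex [c] and the
    rest, and let [A] be the principal submatrix on the rest.  Decomposing the
    walks at their first visit of [c] gives, with [a_k^u] the weighted number of
    walks of length [k] from [u] in [A] followed by a step to [c], the generating
    function identities
      [K_uc(t) = t a^u(t) K_cc(t)],
      [K_uu(t) = A_uu(t) + t^2 a^u(t)^2 K_cc(t)].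
    So if [u, v] are cospectral in one of [A], [K], they are cospectral in the
    other iff [(a^u)^2 = (a^v)^2], i.e. [a^u = +- a^v] since formal power series
    form a domain, i.e. [K_uc = +- K_vc].  Both parts are instances: [K] is the
    cone and [A = G] in (i), [K = G] and [A = G \ c] in (ii). *)

Set Implicit Arguments.
Unset Strict Implicit.
Unset Printing Implicit Defensive.

Import GRing.Theory.
Local Open Scope ring_scope.

(** * Formal power series as coefficient sequences *)

Section ShiftedConvolution.
Variable R : idomainType.
Implicit Types (a b r : nat -> R) (P Q : {poly R}).

(* Coefficients of [t a(t) r(t)]. *)
Definition sconv a r (k : nat) : R := \sum_(i < k) a i * r (k.-1 - i)%N.

Lemma eq_sconv a a' r r' : a =1 a' -> r =1 r' -> sconv a r =1 sconv a' r'.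
Proof. by move=> ea er k; apply: eq_bigr => i _; rewrite ea er. Qed.

Lemma sconvZl p a r k : sconv (fun i => p * a i) r k = p * sconv a r k.
Proof. by rewrite mulr_sumr; apply: eq_bigr => i _; rewrite mulrA. Qed.

Lemma sconvZr p a r k : sconv a (fun i => p * r i) k = p * sconv a r k.
Proof. by rewrite mulr_sumr; apply: eq_bigr => i _; rewrite mulrCA. Qed.

(** The factor ['X] makes coefficients up to [n] depend only on entries below [n], so series can be
    truncated to polynomials. *)
Lemma coef_sconv n a r P Q :
  (forall i, (i < n)%N -> P`_i = a i) -> (forall i, (i < n)%N -> Q`_i = r i) ->
  forall k, (k <= n)%N -> ('X * (P * Q))`_k = sconv a r k.
Proof.
move=> Pa Qr [|k] kn; rewrite coefXM /sconv /= ?big_ord0 // coefM.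
apply: eq_bigr => i _; rewrite Pa ?Qr //.
  exact: leq_ltn_trans (leq_subr _ _) kn.
exact: leq_trans (ltn_ord i) kn.
Qed.

Lemma coefM_low P Q m n :
  (forall i, (i < m)%N -> P`_i = 0) -> (forall i, (i < n)%N -> Q`_i = 0) ->
  (P * Q)`_(m + n) = P`_m * Q`_n.
Proof.
move=> P0 Q0; have mn : (m < (m + n).+1)%N by rewrite ltnS leq_addr.
rewrite coefM (bigD1 (Ordinal mn)) //= addKn big1 ?addr0 // => i neq.
case: (ltngtP i m) => [im|mi|im].
- by rewrite P0 // mul0r.
- rewrite Q0 ?mulr0 // ltn_subLR ?ltn_add2r //.
  by rewrite -ltnS ltn_ord.
- by move: neq; rewrite -val_eqE /= im eqxx.
Qed.

Lemma coefM_low0 P Q n k :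
  (forall i, (i < n)%N -> Q`_i = 0) -> (k < n)%N -> (P * Q)`_k = 0.
Proof.
move=> Q0 kn; rewrite coefM big1 // => i _.
by rewrite Q0 ?mulr0 //; apply: leq_ltn_trans (leq_subr _ _) kn.
Qed.

Lemma first_nonzero a : (exists i, a i != 0) ->
  exists2 m, a m != 0 & forall i, (i < m)%N -> a i = 0.
Proof.
move=> ex; case: (ex_minnP ex) => m am min; exists m => // i im.
by apply/eqP; apply: contraTT im => /min; rewrite -leqNgt.
Qed.

(** The two sides differ by t^2 (a - b)(a + b) r. If a - b and a + b had lowest terms in degrees m
    and n, the coefficient in degree m + n + 2 would be a product of nonzero elements. *)
Lemma sconv_sqr_inj a b r : r 0%N != 0 ->
  sconv a (sconv a r) =1 sconv b (sconv b r) ->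
  (a =1 b) \/ (forall k, a k = - b k).
Proof.
move=> r0 eqab; case: (pselect (exists i, a i - b i != 0)) => [|nex]; last first.
  by left=> k; apply/eqP; rewrite -subr_eq0; apply/negPn/negP=> h; apply: nex; exists k.
case: (pselect (exists i, a i + b i != 0)) => [|nex]; last first.
  by right=> k; apply/eqP; rewrite -addr_eq0; apply/negPn/negP=> h; apply: nex; exists k.
move=> /first_nonzero[n en e0] /first_nonzero[m dm d0]; exfalso.
(* Degrees up to m + n + 1 are all that can enter coefficient m + n + 2 of the products below. *)
pose T f := \poly_(i < (m + n).+2) f i : {poly R}.
have TE f i : (i < (m + n).+2)%N -> (T f)`_i = f i by move=> lt; rewrite coef_poly lt.
have E f : ('X * (T f * ('X * (T f * T r))))`_(m + n).+2 = sconv f (sconv f r) (m + n).+2.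
  apply: (@coef_sconv (m + n).+2) => // i lt; first exact: TE.
  by apply: (@coef_sconv (m + n).+2); [exact: TE|exact: TE|exact: ltnW].
have: ('X * (T a * ('X * (T a * T r))) - 'X * (T b * ('X * (T b * T r))))`_(m + n).+2 = 0.
  by rewrite coefB !E eqab subrr.
have -> : 'X * (T a * ('X * (T a * T r))) - 'X * (T b * ('X * (T b * T r)))
    = 'X * ('X * ((T a - T b) * ((T a + T b) * T r))) by ring.
have De i : (i <= m + n)%N -> (T a - T b)`_i = a i - b i.
  by move=> le; rewrite coefB !TE // ltnS leqW.
have Ee i : (i <= m + n)%N -> (T a + T b)`_i = a i + b i.
  by move=> le; rewrite coefD !TE // ltnS leqW.
have E0 i : (i < n)%N -> (T a + T b)`_i = 0.
  by move=> lt; rewrite Ee ?e0 // (leq_trans (ltnW lt)) ?leq_addl.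
rewrite !coefXM /= coefM_low; last 2 first.
- by move=> i lt; rewrite De ?d0 // (leq_trans (ltnW lt)) ?leq_addr.
- by move=> i lt; rewrite mulrC; exact: coefM_low0 lt.
rewrite -[X in _ * _`_X = _]addn0 coefM_low //.
rewrite De ?leq_addr // Ee ?leq_addl // TE //.
by apply/eqP; rewrite !mulf_neq0.
Qed.

(** Once the values below [k] agree, coefficient [k.+1] compares only [a k * r 0] with
    [b k * r 0]. *)
Lemma sconv_inj a b r : r 0%N != 0 -> sconv a r =1 sconv b r -> a =1 b.
Proof.
move=> r0 eqab k; elim/ltn_ind: k => k IH.
have := eqab k.+1; rewrite /sconv !big_ord_recr /= subnn.
under eq_bigr => i _ do rewrite IH //.
by move/addrI/(mulIf r0).
Qed.

End ShiftedConvolution.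

Lemma trmx_exp (R : comNzRingType) n (A : 'M[R]_n) k : (A ^+ k)^T = A^T ^+ k.
Proof.
elim: k => [|k IH]; first by rewrite !expr0 trmx1.
by rewrite exprS exprSr trmx_mul IH.
Qed.

(** By Cayley-Hamilton, every power of [A] reduces modulo the characteristic polynomial to a
    combination of the first [n] powers. *)
Lemma krylov_eq0 (F : fieldType) n (A : 'M[F]_n) (x : 'rV_n) (w : 'cV_n) :
  (forall k, (k < n)%N -> x *m A ^+ k *m w = 0) ->
  forall k, x *m A ^+ k *m w = 0.
Proof.
case: n A x w => [|n] A x w xw k; first by rewrite thinmx0 !mul0mx.
have -> : A ^+ k = horner_mx A ('X^k %% char_poly A).
  rewrite -{1}(horner_mx_X A) -rmorphXn /= {1}(divp_eq 'X^k (char_poly A)).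
  by rewrite rmorphD rmorphM /= Cayley_Hamilton mulr0 add0r.
set q := _ %% _.
have sq : (size q <= n.+1)%N.
  rewrite -ltnS -(size_char_poly A) ltn_modp.
  exact: monic_neq0 (char_poly_monic A).
rewrite -[q]coefK poly_def rmorph_sum mulmx_sumr mulmx_suml big1 // => i _.
rewrite /= horner_mxZ rmorphXn /= horner_mx_X -scalemxAr -scalemxAl xw ?scaler0 //.
exact: leq_trans (ltn_ord i) sq.
Qed.

(** * Walks relative to a distinguished vertex *)

Section SplitVertex.
Variables (R : realType) (n m : nat) (K : 'M[R]_n) (c : 'I_n) (f : 'I_m -> 'I_n).
Hypothesis K_sym : K^T = K.
Hypothesis f_inj : injective f.
Hypothesis f_neq : forall i, f i != c.
(** With the two hypotheses above, [f] enumerates the vertices other than [c]; keeping it abstract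
    covers both [lshift 1] and [lift c]. *)
Hypothesis sum_split : forall F : 'I_n -> R, \sum_x F x = F c + \sum_i F (f i).

Let A := mxsub f f K.
Let w : 'cV[R]_m := \col_i K (f i) c.
Let a (i : 'I_m) (k : nat) : R := (A ^+ k *m w) i 0.

Lemma first_visit k i x :
  (K ^+ k) (f i) x = (A ^+ k *m \col_j (f j == x)%:R) i 0
                     + sconv (a i) (fun l => (K ^+ l) c x) k.
Proof.
pose X l : 'cV[R]_m := \col_j (K ^+ l) (f j) x.
have XS l : X l.+1 = A *m X l + (K ^+ l) c x *: w.
  apply/matrixP=> j o; rewrite !mxE exprS mxE sum_split addrC mulrC.
  by congr (_ + _); apply: eq_bigr => y _; rewrite !mxE.
(* Unrolling [XS]: [o] counts the steps taken before the step that first enters [c]. *)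
have XE l : X l = A ^+ l *m \col_j (f j == x)%:R
                  + \sum_(o < l) (K ^+ (l.-1 - o)) c x *: (A ^+ o *m w).
  elim: l => [|l IH].
    by rewrite expr0 big_ord0 addr0 mul1mx; apply/matrixP=> j o; rewrite !mxE.
  rewrite XS IH mulmxDr mulmxA big_ord_recl /= subn0 expr0 mul1mx exprS -addrA.
  congr (_ + _); rewrite addrC; congr (_ + _).
  rewrite mulmx_sumr; apply: eq_bigr => o _.
  rewrite -scalemxAr mulmxA exprS; congr ((K ^+ _) c x *: _).
  (* The exponents [l.-1 - o] and [l - o.+1] agree; for [l = 0] there is no index [o]. *)
  by rewrite /bump /= add1n; case: l o {IH} => [[]|l o].
have /matrixP/(_ i 0) := XE k; rewrite [LHS]mxE => ->.
rewrite mxE summxE; congr (_ + _); apply: eq_bigr => o _.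
by rewrite mxE mulrC.
Qed.

Lemma walks_to_split k i :
  (K ^+ k) (f i) c = sconv (a i) (fun l => (K ^+ l) c c) k.
Proof.
rewrite first_visit (_ : \col_j _ = 0) ?mulmx0 ?mxE ?add0r //.
by apply/matrixP=> j o; rewrite !mxE (negPf (f_neq j)).
Qed.

(** After the first visit the walk runs from [c] to [f i]. Symmetry reverses this remainder and
    [walks_to_split] expands it, hence the nested [sconv]. *)
Lemma closed_walks k i :
  (K ^+ k) (f i) (f i) = (A ^+ k) i i
    + sconv (a i) (sconv (a i) (fun l => (K ^+ l) c c)) k.
Proof.
rewrite first_visit; congr (_ + _).
  rewrite mxE (bigD1 i) //= mxE eqxx mulr1 big1 ?addr0 // => j ji.
  by rewrite mxE (inj_eq f_inj) (negPf ji) mulr0.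
apply: eq_sconv => // l.
by rewrite -walks_to_split -[in LHS]K_sym -trmx_exp mxE.
Qed.

Let r0 : (K ^+ 0) c c != 0.
Proof. by rewrite expr0 mxE eqxx oner_neq0. Qed.

Lemma closed_walks_parity u v :
  (forall k, sconv (a u) (sconv (a u) (fun l => (K ^+ l) c c)) k
           = sconv (a v) (sconv (a v) (fun l => (K ^+ l) c c)) k) <->
  exists p : R, parity p /\ forall k, a u k = p * a v k.
Proof.
split.
  move/(sconv_sqr_inj r0) => [h|h]; [exists 1|exists (-1)].
    by split=> [|k]; [left|rewrite mul1r].
  by split=> [|k]; [right|rewrite mulN1r].
move=> [p [pp h]] k.
have E l : sconv (a u) (fun l => (K ^+ l) c c) l
         = p * sconv (a v) (fun l => (K ^+ l) c c) l.
  by rewrite -sconvZl; apply: eq_sconv.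
rewrite (eq_sconv h E) sconvZl sconvZr mulrA.
by case: pp => ->; rewrite ?mulrNN mulr1 mul1r.
Qed.

Lemma cospectral_extend u v : cospectral A u v ->
  cospectral K (f u) (f v) <->
  exists p : R, parity p /\ forall k, a u k = p * a v k.
Proof.
move=> cA; rewrite -closed_walks_parity; split=> h k.
  by apply: (addrI ((A ^+ k) u u)); rewrite {2}cA -!closed_walks.
by rewrite !closed_walks cA h.
Qed.

(** Multiplication by t K_cc(t) is injective, as K_cc has constant term 1; so a^u = p a^v amounts to
    K_uc = p K_vc. *)
Lemma cospectral_restrict u v : cospectral K (f u) (f v) ->
  cospectral A u v <->
  exists p : R, parity p /\ walk_singlet K (f u) (f v) c p.
Proof.
move=> cK.
have -> : (exists p : R, parity p /\ walk_singlet K (f u) (f v) c p) <->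
          (exists p : R, parity p /\ forall k, a u k = p * a v k).
  split=> -[p [pp h]]; exists p; split=> // k.
    move: k; apply: (@sconv_inj _ (a u) _ (fun l => (K ^+ l) c c) r0) => k.
    by rewrite sconvZl -!walks_to_split.
  by rewrite !walks_to_split -sconvZl; apply: eq_sconv.
rewrite -closed_walks_parity; split=> h k.
  by apply: (addrI ((A ^+ k) u u)); rewrite {2}h -!closed_walks.
by have := cK k; rewrite !closed_walks h => /addIr.
Qed.

End SplitVertex.

(** * Walk multiplets and the two equivalences *)

Lemma mulmx_indicator (R : realType) n (B : 'M[R]_n) (M : {set 'I_n}) gamma i :
  (B *m indicator M gamma) i 0 = \sum_(m in M) gamma m * B i m.
Proof.
rewrite mxE [RHS]big_mkcond; apply: eq_bigr => j _; rewrite mxE.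
by case: ifP; rewrite ?mulr0 // mulrC.
Qed.

Lemma walk_multipletP (R : realType) n (G : 'M[R]_n) u v M gamma p :
  walk_multiplet G u v M gamma p <->
  forall k, (G ^+ k *m indicator M gamma) u 0
            = p * (G ^+ k *m indicator M gamma) v 0.
Proof.
split=> h k; last by move=> _; rewrite -!mulmx_indicator.
(* The multiplet condition says that this row annihilates each [G ^+ k *m indicator M gamma]. *)
pose x : 'rV[R]_n := delta_mx 0 u - p *: delta_mx 0 v.
have xE l : (x *m G ^+ l *m indicator M gamma) 0 0
    = (G ^+ l *m indicator M gamma) u 0 - p * (G ^+ l *m indicator M gamma) v 0.
  by rewrite -mulmxA mulmxBl -scalemxAl -!rowE !mxE.
apply/eqP; rewrite -subr_eq0 -xE krylov_eq0 ?mxE // => l ln.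
by apply/matrixP=> i j; rewrite !ord1 xE !mulmx_indicator h // subrr mxE.
Qed.

Theorem theorem3 (R : realType) (N : nat) (G : 'M[R]_N) (u v : 'I_N)
    (G_sym : G^T = G) (neq_uv : u <> v) (cosp_uv : cospectral G u v) :
  (forall (M : {set 'I_N}) (gamma : 'I_N -> R),
     cospectral (cone G M gamma) (lshift 1 u) (lshift 1 v) <->
     exists p : R, parity p /\ walk_multiplet G u v M gamma p)
  /\
  (forall c : 'I_N,
     cospectral_del G c u v <->
     exists p : R, parity p /\ walk_singlet G u v c p).
Proof.
split=> [M gamma|c].
  (* The apex is the distinguished vertex: the rest is [G], and the column into the apex is the
     indicator, so a^u lists the multiplet sums. *)
  have GE : mxsub (@lshift N 1) (@lshift N 1) (cone G M gamma) = G.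
    by apply/matrixP=> i j; rewrite mxE block_mxEul.
  have wE : \col_i cone G M gamma (lshift 1 i) (rshift N 0) = indicator M gamma.
    by apply/matrixP=> i j; rewrite mxE block_mxEur ord1.
  have := @cospectral_extend R _ _ (cone G M gamma) (rshift N 0) (@lshift N 1).
  rewrite GE wE => ->; first last.
  - exact: cosp_uv.
  - by move=> F; rewrite big_split_ord /= big_ord1 addrC.
  - by move=> i; rewrite eq_lrshift.
  - exact: lshift_inj.
  - by rewrite tr_block_mx G_sym trmxK trmx0.
  by split=> -[p [pp h]]; exists p; split=> //; apply/walk_multipletP.
have delE : vertex_del G c = mxsub (lift c) (lift c) G.
  by apply/matrixP=> i j; rewrite !mxE.
have res u' v' : cospectral G (lift c u') (lift c v') ->
    cospectral (vertex_del G c) u' v' <->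
    exists p : R, parity p /\ walk_singlet G (lift c u') (lift c v') c p.
  rewrite delE; apply: cospectral_restrict => //.
  - exact: lift_inj.
  - by move=> i; rewrite eq_sym neq_lift.
  - by move=> F; rewrite (bigD1_ord c).
split=> [[u' [v' [eu ev cR]]]|[p [pp h]]].
  by subst u v; apply/res.
(* Length 0 shows that [u] and [v] survive the deletion: it equates [u = c] with p [v = c], so, [u]
   and [v] being distinct, [c] is neither. *)
have h0 := h 0%N; rewrite expr0 !mxE in h0.
have cu : c != u.
  apply/eqP=> cu; move: h0; rewrite cu eqxx.
  have /eqP/negPf -> : v <> u by move/esym.
  by move/eqP; rewrite mulr0 oner_eq0.
have cv : c != v.
  apply/eqP=> cv; move: h0; rewrite cv eqxx; move/eqP/negPf: neq_uv => ->.
  by case: pp => -> /eqP; rewrite mulr1 eq_sym ?oppr_eq0 oner_eq0.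
have [u' eu _] := unlift_some cu; have [v' ev _] := unlift_some cv.
exists u', v'; split; [exact: esym|exact: esym|].
by subst u v; apply/res => //; exists p.
Qed.
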